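(* Let $n\in\mathbb{N}=\{1,2,\dots\}$. For every $x>0$ the polynomial $p_n$ is given by the absolutely convergent series $$p_n(x)=2e^{x}\sum_{m=1}^\infty(-1)^m m^{2n} I_m(x).$$ Moreover, $$p_n(x)=\sum_{k=1}^n a_{k,n}x^k,$$ where $$a_{k,n}=\frac1{k!}\sum_{r=0}^{k}\frac{(-1)^r}{2^r}\binom{k}{r}\sum_{j=0}^{k-r}\frac{(-1)^j}{2^j}\binom{k-r}{j}(r-j)^{2n}.$$ Finally, the following combinatorial identities hold: $$\sum_{r=0}^{k}\frac{(-1)^r}{2^r}\binom{k}{r}\sum_{j=0}^{k-r}\frac{(-1)^j}{2^j}\binom{k-r}{j}(r-j)^{2n}=0,\qquad k=n+1,n+2,\dots,2n,$$ $$\sum_{r=0}^{n}\frac{(-1)^r}{2^r}\binom{n}{r}\sum_{j=0}^{n-r}\frac{(-1)^j}{2^j}\binom{n-r}{j}(r-j)^{2n}=(-1)^n\,n!\,(2n-1)!!.$$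
   Context: Let $\mathcal{A}_x$ be the differential operator $\mathcal{A}_x = x^2 - x\frac{d}{dx}x\frac{d}{dx}$, i.e. $(\mathcal{A}_x f)(x)=x^2f(x)-x\,(x f'(x))'$. For $n\in\mathbb{N}_0$ define $p_n(x)=(-1)^n e^{x}\mathcal{A}_x^n e^{-x}$, where $\mathcal{A}_x^n$ is the $n$-th iterate. Each $p_n$ is a polynomial of degree $n$ in $x$. $I_\nu$ denotes the modified Bessel function $I_\nu(x)=\sum_{k=0}^\infty\frac{(x/2)^{2k+\nu}}{k!\,\Gamma(k+1+\nu)}$. $(2n-1)!!=1\cdot3\cdot5\cdots(2n-1)$. *)

(* Defs.v *)
From HB Require Import structures.
From mathcomp Require Import all_boot all_order all_algebra.
From mathcomp Require Import all_classical all_reals all_analysis.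

Set Implicit Arguments.
Unset Strict Implicit.
Unset Printing Implicit Defensive.

Import Order.TTheory GRing.Theory Num.Theory.
Import numFieldNormedType.Exports.

Local Open Scope classical_set_scope.
Local Open Scope ring_scope.

Definition opA (R : realType) (f : R -> R) : R -> R :=
  fun x => x ^+ 2 * f x - x * derive1 (fun y => y * derive1 f y) x.

Definition pfun (R : realType) (n : nat) (x : R) : R :=
  (-1) ^+ n * expR x * iter n (@opA R) (fun y => expR (- y)) x.

(* Euler's integral of the second kind; it is the Gamma function for z > 0. *)
Definition Gamma (R : realType) (z : R) : R :=
  \int[lebesgue_measure]_(t in `]0, +oo[) (t `^ (z - 1) * expR (- t)).

(* Meaningful for 0 < x and -1 < nu, so that Gamma is only used at positive
   arguments. *)
Definition besselI (R : realType) (nu x : R) : R :=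
  \big[+%R/0]_(0 <= k <oo)
    ((x / 2) `^ ((2 * k)%:R + nu) / (k`!%:R * Gamma (k%:R + 1 + nu))).

Definition binom_dsum (R : realType) (k n : nat) : R :=
  \sum_(0 <= r < k.+1) (-1) ^+ r / 2 ^+ r * 'C(k, r)%:R *
    \sum_(0 <= j < (k - r).+1) (-1) ^+ j / 2 ^+ j * 'C(k - r, j)%:R *
      (r%:R - j%:R) ^+ (2 * n).

Definition acoef (R : realType) (k n : nat) : R := (k`!%:R)^-1 * binom_dsum R k n.

(* The double factorial (2n - 1)!!. *)
Definition odd_dfact (n : nat) : nat := \prod_(1 <= i < n.+1) (2 * i - 1).

(* Main.v *)
Require Import Defs.
From mathcomp Require Import all_boot all_order all_algebra.
From mathcomp Require Import all_classical all_reals all_analysis.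
From mathcomp Require Import measurable_realfun ring zify.
Import Order.TTheory GRing.Theory Num.Theory.
Import numFieldNormedType.Exports.
Local Open Scope classical_set_scope.
Local Open Scope ring_scope.

(** Everything is read off from one generating function.  In the trinomial
    expansion of (1 - cosh t)^k = (1 - z/2 - 1/(2z))^k, z = e^t, the indices r
    and j of the double sum contribute the monomial z^(r - j), whose derivative
    of order 2n at t = 0 is (r - j)^(2n).  So [binom_dsum R k n] is the
    derivative of order 2n of (1 - cosh t)^k at t = 0 ([binom_dsumE], where this
    derivative is called [central_moment]).

    Since 1 - cosh t = - t^2/2 + ..., that derivative vanishes for k > n and has
    the stated value for k = n.  The proof extracts both facts from the
    differential equation
      (c^k)'' = k^2 c^k - k(2k-1) c^(k-1)     with c = 1 - cosh t,
    which makes the central moments satisfy a two-term recurrence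
    ([central_momentSS]).

    Conjugating the differential operator by e^(-x) turns it into an operator on
    polynomials whose action on the coefficients of x^k is, after division by
    k!, the very same recurrence ([coef_conjA]).  Hence p_n has the announced
    coefficients ([pfun_central_moment]).

    For the Bessel series, expand cosh^N = (1 - c)^N by the binomial theorem and
    differentiate 2n times at 0: the moments sum_k 'C(N, k) (N - 2k)^(2n) / 2^N
    are a combination of 'C(N, k), k <= n, with coefficients
    (-1)^k [central_moment] ([sum_binom_central_moment]).  Summing against
    z^N / N! gives e^z p_n(-z) ([cvg_binom_moment]).  On the other hand, the
    double series obtained by inserting the power series of I_m, regrouped
    by the total degree N = 2k + m, is half of this sum at z = - x, because the
    moment is symmetric under k |-> N - k and the parity of m is that of N.  The
    sum of the absolute values along the diagonals is the same expression at
    z = x, so the same lemma also supplies the domination which justifies the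
    regrouping ([cvg_triangular_sum]). *)

(** * Laurent polynomials and the Euler operator *)

Section EulerOperator.
Context (F : numFieldType).
Implicit Types (p q : {poly F}) (d e k n N : nat).

(** A Laurent polynomial X^(-d) p is represented by the pair (d, p).  On such
    representatives [eulerD d] is the Euler operator X d/dX, that is d/dt when
    X = e^t. *)
Definition eulerD d p : {poly F} := 'X * p^`() - p *+ d.

Lemma eulerDP d a p q : eulerD d (a *: p + q) = a *: eulerD d p + eulerD d q.
Proof.
rewrite /eulerD derivD derivZ mulrDr mulrnDl -scalerAr scalerBr scalerMnr.
by rewrite opprD addrACA.
Qed.

Lemma iter_eulerDP d N a p q :
  iter N (eulerD d) (a *: p + q) =
  a *: iter N (eulerD d) p + iter N (eulerD d) q.
Proof. by elim: N => //= N ->; rewrite eulerDP. Qed.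

Lemma iter_eulerD0 d N : iter N (eulerD d) 0 = 0.
Proof. by elim: N => //= N ->; rewrite /eulerD deriv0 mulr0 mul0rn subr0. Qed.

Lemma iter_eulerD_sum d N (I : Type) (r : seq I) (a : I -> F)
    (P : I -> {poly F}) :
  iter N (eulerD d) (\sum_(i <- r) a i *: P i) =
  \sum_(i <- r) a i *: iter N (eulerD d) (P i).
Proof.
elim: r => [|i r IH]; first by rewrite !big_nil iter_eulerD0.
by rewrite !big_cons iter_eulerDP IH.
Qed.

Lemma iter_eulerD_Xn d N m :
  iter N (eulerD d) 'X^m = (m%:R - d%:R) ^+ N *: 'X^m.
Proof.
elim: N => [|N IH]; first by rewrite expr0 scale1r.
rewrite iterS IH -[_ *: 'X^m in LHS]addr0 eulerDP.
rewrite [eulerD d 0](iter_eulerD0 d 1) addr0 exprSr -scalerA; congr (_ *: _).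
rewrite /eulerD derivXn mulrnAr scalerBl !scaler_nat.
by case: m {IH} => [|m]; rewrite ?mulr0n -?exprS.
Qed.

Lemma eulerDM d e p q :
  eulerD (d + e) (p * q) = eulerD d p * q + p * eulerD e q.
Proof.
rewrite /eulerD derivM -(mulr_natr p) -(mulr_natr q) -(mulr_natr (p * q)) natrD.
by ring.
Qed.

(** The chain rule for X^(-d) p raised to the power k + 1. *)
Lemma eulerD_expr d k p :
  eulerD (k.+1 * d) (p ^+ k.+1) = (p ^+ k * eulerD d p) *+ k.+1.
Proof.
elim: k => [|k IH]; first by rewrite mul1n !expr1 expr0 mul1r mulr1n.
rewrite mulSn exprS eulerDM IH [in RHS]mulrS mulrnAr mulrA -exprS.
by rewrite [eulerD d p * _]mulrC.
Qed.

(** The pairs (d, p) and (d + e, X^e p) represent the same Laurent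
    polynomial. *)
Lemma iter_eulerD_mulXn d e N p :
  iter N (eulerD (d + e)) ('X^e * p) = 'X^e * iter N (eulerD d) p.
Proof.
have Xe0 : eulerD e 'X^e = 0.
  by have := iter_eulerD_Xn e 1 e; rewrite subrr expr1 scale0r.
by elim: N => //= N ->; rewrite addnC eulerDM Xe0 mul0r add0r.
Qed.

(** X^(-1) [versine] is 1 - (X + X^(-1))/2, that is 1 - cosh t for X = e^t. *)
Definition versine : {poly F} := 'X - 2^-1 *: ('X ^+ 2 + 1).

(** The first derivative of 1 - cosh t, namely - sinh t. *)
Lemma eulerD_versine : eulerD 1 versine = 2^-1 *: (1 - 'X ^+ 2).
Proof.
have h2 : (2^-1)%:P * 2 = 1 :> {poly F}.
  by rewrite -polyC_natr -polyCM mulVf ?pnatr_eq0.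
rewrite /eulerD /versine derivB derivZ derivD derivX derivC -!mul_polyC.
rewrite expr2 derivM derivX mulr1n; ring: h2.
Qed.

(** The second derivative of c = 1 - cosh t is - cosh t = c - 1. *)
Lemma eulerD2_versine : eulerD 1 (eulerD 1 versine) = versine - 'X.
Proof.
have h2 : (2^-1)%:P * 2 = 1 :> {poly F}.
  by rewrite -polyC_natr -polyCM mulVf ?pnatr_eq0.
rewrite eulerD_versine /eulerD /versine derivZ derivB derivC -!mul_polyC.
rewrite expr2 derivM derivX mulr1n; ring: h2.
Qed.

(** This is sinh^2 = c^2 - 2c for c = 1 - cosh t. *)
Lemma sqr_eulerD_versine :
  eulerD 1 versine ^+ 2 = versine ^+ 2 - versine * 'X *+ 2.
Proof.
have h2 : (2^-1)%:P * 2 = 1 :> {poly F}.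
  by rewrite -polyC_natr -polyCM mulVf ?pnatr_eq0.
have h4 : (2^-1)%:P ^+ 2 * 4 = 1 :> {poly F}.
  by rewrite -[4]/((2 * 2)%:R) natrM mulrACA h2 mul1r.
rewrite eulerD_versine /versine -!mul_polyC.
move: (2^-1)%:P h2 h4 => c h2 h4.
apply/eqP; rewrite -subr_eq0; apply/eqP.
transitivity ((1 - c ^+ 2 * 4) * 'X ^+ 2); last by rewrite h4 subrr mul0r.
by ring.
Qed.

(** The differential equation of c^(k+1) for c = 1 - cosh t: differentiating
    twice produces c^k (c - 1) and c^(k-1) sinh^2, and sinh^2 is eliminated by
    the previous lemma.  The factor X compensates the different shifts of
    c^(k+1) and c^k. *)
Lemma iter2_eulerD_versine k :
  iter 2 (eulerD k.+1) (versine ^+ k.+1) =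
  (k.+1 ^ 2)%:R *: versine ^+ k.+1 -
  (k.+1 * (2 * k).+1)%:R *: ('X * versine ^+ k).
Proof.
have Dk j : eulerD j.+1 (versine ^+ j.+1) =
    j.+1%:R *: (versine ^+ j * eulerD 1 versine).
  by have := eulerD_expr 1 j versine; rewrite muln1 scaler_nat.
have Z d (a : F) p : eulerD d (a *: p) = a *: eulerD d p.
  by rewrite -[a *: p]addr0 eulerDP [eulerD d 0](iter_eulerD0 d 1) addr0.
rewrite /iter /= Dk Z -[X in eulerD X _]addn1 eulerDM eulerD2_versine.
case: k => [|k].
  rewrite !expr0 mul1r [eulerD 0 1](iter_eulerD_Xn 0 1 0) subrr expr1 scale0r.
  by rewrite mul0r add0r !scale1r ?mulr1 ?mul1r expr1.
rewrite Dk -scalerAl -mulrA -expr2 sqr_eulerD_versine -!mul_polyC.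
rewrite !polyC_natr !exprS.
move: (versine ^+ k) versine => w v.
by ring.
Qed.

(** The derivative of order 2n of (1 - cosh t)^k at t = 0, which is X = 1. *)
Definition central_moment k n : F :=
  (iter (2 * n) (eulerD k) (versine ^+ k)).[1].

Lemma central_moment0S n : central_moment 0 n.+1 = 0.
Proof.
rewrite /central_moment -[versine ^+ 0]/'X^0 iter_eulerD_Xn subrr mulnS.
by rewrite expr0n scale0r horner0.
Qed.

Lemma central_momentS0 k : central_moment k.+1 0 = 0.
Proof.
rewrite /central_moment muln0 /= horner_exp /versine !hornerE expr1n.
by rewrite mulVf ?pnatr_eq0 // subrr expr0n.
Qed.

Lemma central_momentSS k n :
  central_moment k.+1 n.+1 = (k.+1 ^ 2)%:R * central_moment k.+1 n -
    (k.+1 * (2 * k).+1)%:R * central_moment k n.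
Proof.
rewrite /central_moment mulnS addnC iterD iter2_eulerD_versine iter_eulerDP.
rewrite -scaleNr -[_ *: ('X * _)]addr0 iter_eulerDP iter_eulerD0 addr0.
rewrite -[in X in _ + X]addn1 -[X in X * versine ^+ k]expr1 iter_eulerD_mulXn.
by rewrite hornerD !hornerZ hornerM hornerXn expr1n mul1r mulNr addn1.
Qed.

(** The recurrence propagates the vanishing of (1 - cosh t)^k at 0 down the
    triangle; this is the fact that (1 - cosh t)^k = O(t^(2k)). *)
Lemma central_moment_small k n : (n < k)%N -> central_moment k n = 0.
Proof.
elim: n k => [|n IH] [|k] // nk; first exact: central_momentS0.
by rewrite central_momentSS !IH ?mulr0 ?subrr // ltnW.
Qed.

(** On the diagonal only the second term of the recurrence survives, and it
    multiplies the previous value by - (n + 1) (2n + 1). *)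
Lemma central_moment_diag n :
  central_moment n n = (-1) ^+ n * n`!%:R * (odd_dfact n)%:R.
Proof.
elim: n => [|n IH].
  by rewrite /central_moment /odd_dfact big_nil expr0 hornerC !mul1r.
rewrite central_momentSS central_moment_small // mulr0 sub0r IH.
have -> : odd_dfact n.+1 = (odd_dfact n * (2 * n).+1)%N.
  by rewrite /odd_dfact big_nat_recr //=; congr (_ * _)%N; lia.
rewrite factS !natrM exprS.
by ring.
Qed.

(** Both sides are the derivative of order 2n at 0 of cosh^N: on the left cosh
    is (X + X^(-1))/2, on the right it is 1 - (1 - cosh).  Terms with k > n
    vanish, which allows an upper bound independent of N. *)
Lemma sum_binom_central_moment N n :
  (2 ^+ N)^-1 * \sum_(0 <= k < N.+1) 'C(N, k)%:R * (N%:R - 2 * k%:R) ^+ (2 * n)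
  = \sum_(0 <= k < n.+1) 'C(N, k)%:R * (-1) ^+ k * central_moment k n :> F.
Proof.
(* Both ranges reach all k for which the binomial and the moment are nonzero. *)
transitivity (\sum_(0 <= k < N.+1)
    'C(N, k)%:R * (-1) ^+ k * central_moment k n); last first.
  have [le_nN|/ltnW le_Nn] := leqP n N.
    rewrite (big_cat_nat (n := n.+1)) //= [X in _ + X]big_nat_cond
      [X in _ + X]big1 ?addr0 //.
    by move=> k /andP[/andP[lt_nk _] _]; rewrite central_moment_small ?mulr0.
  rewrite [RHS](big_cat_nat (n := N.+1)) //= [X in _ + X]big_nat_cond.
  rewrite [X in _ + X]big1 ?addr0 // => k /andP[/andP[lt_Nk _] _].
  by rewrite bin_small // !mul0r.
have expand_binom : ('X - versine) ^+ N =
    \sum_(k < N.+1) ((2 ^+ N)^-1 * 'C(N, k)%:R) *: 'X^(2 * (N - k)) :> {poly F}.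
  rewrite /versine opprB addrC subrK exprZn exprDn scaler_sumr.
  apply: eq_bigr => k _; rewrite expr1n mulr1 -exprM exprVn.
  by rewrite -scalerA scaler_nat.
have expand_versine : ('X - versine) ^+ N =
    \sum_(k < N.+1) ('C(N, k)%:R * (-1) ^+ k) *: ('X^(N - k) * versine ^+ k).
  rewrite exprDn; apply: eq_bigr => k _.
  rewrite (exprNn versine) mulrCA -[RHS]mul_polyC.
  rewrite polyCM polyC_natr polyC_exp polyCN.
  by rewrite -mulrA -mulr_natl.
have := etrans (esym expand_binom) expand_versine.
move=> /(congr1 (fun p => (iter (2 * n) (eulerD N) p).[1])).
rewrite !iter_eulerD_sum !horner_sum !big_mkord mulr_sumr => E.
etransitivity; first last; first (etransitivity; first exact: E).
  apply: eq_bigr => k _; rewrite hornerZ; congr (_ * _).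
  have le_kN : (k <= N)%N by rewrite -ltnS.
  rewrite -[in eulerD N](subnKC le_kN) iter_eulerD_mulXn hornerM hornerXn.
  by rewrite expr1n mul1r.
apply: eq_bigr => k _; rewrite hornerZ iter_eulerD_Xn hornerZ hornerXn expr1n.
rewrite mulr1 mulrA; congr (_ * _ ^+ _).
have le_kN : (k <= N)%N by rewrite -ltnS.
by rewrite natrM natrB //; ring.
Qed.

End EulerOperator.

(** The trinomial expansion of (X - X^2/2 - 1/2)^k, where the power of - X^2/2
    is r and that of - 1/2 is j, consists of monomials X^(k + r - j); on each of
    them, with shift k, the Euler operator acts by the factor r - j. *)
Lemma binom_dsumE (R : realType) k n : binom_dsum R k n = central_moment R k n.
Proof.
have pw i : (- 2^-1 : R) ^+ i = (-1) ^+ i / 2 ^+ i.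
  by rewrite (exprNn 2^-1) exprVn.
have expand : versine R ^+ k =
    \sum_(r < k.+1) ((-1) ^+ r / 2 ^+ r * 'C(k, r)%:R) *:
      \sum_(j < (k - r).+1) ((-1) ^+ j / 2 ^+ j * 'C(k - r, j)%:R) *:
        'X^(k + r - j).
  have -> : versine R = ('X - 2^-1%:P) + (- 2^-1) *: 'X^2.
    by rewrite /versine -!mul_polyC polyCN; ring.
  rewrite exprDn; apply: eq_bigr => r _.
  rewrite exprDn mulr_suml -sumrMnl scaler_sumr; apply: eq_bigr => j _.
  rewrite -polyCN -polyC_exp exprZn !pw -!mul_polyC.
  rewrite !polyCM !polyC_natr.
  have lt_j := ltn_ord j; have lt_r := ltn_ord r.
  have -> : (k + r - j = (k - r - j) + 2 * r)%N by lia.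
  rewrite exprD exprM; ring.
rewrite /central_moment expand iter_eulerD_sum horner_sum /binom_dsum big_mkord.
apply: eq_bigr => r _; rewrite hornerZ iter_eulerD_sum horner_sum big_mkord.
congr (_ * _); apply: eq_bigr => j _.
rewrite hornerZ iter_eulerD_Xn hornerZ hornerXn expr1n mulr1.
congr (_ * _ ^+ _); have lt_j := ltn_ord j; have lt_r := ltn_ord r.
by rewrite natrB ?natrD; [ring | lia].
Qed.

(** * The polynomials p_n *)

Section ConjugatedOperator.
Context {R : realType}.
Implicit Types (p q : {poly R}) (x : R).

Lemma is_derive_expRNM p x :
  is_derive x 1 (fun y => expR (- y) * p.[y]) (expR (- x) * (p^`() - p).[x]).
Proof.
have dN : is_derive x (1 : R) (fun y : R => expR (- y)) (- expR (- x)).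
  rewrite -mulN1r mulrC.
  by apply: (is_derive1_comp (f := expR) (g := -%R)).
apply: (is_derive_eq (is_deriveM dN (is_derive_poly p x))).
rewrite /GRing.scale /= hornerD hornerN; ring.
Qed.

Lemma derive1_expRNM p :
  derive1 (fun y => expR (- y) * p.[y]) = fun y => expR (- y) * (p^`() - p).[y].
Proof.
by apply/funext => x; rewrite derive1E; have [_ ->] := is_derive_expRNM p x.
Qed.

(** Minus the operator e^x A e^(-x) on polynomials.  The sign absorbs the factor
    (-1)^n of p_n. *)
Definition conjA q : {poly R} :=
  'X * ('X * q^`())^`() - 'X * q - 2 *: ('X * ('X * q^`())).

Lemma opA_expRNM q :
  opA (fun y => expR (- y) * q.[y]) = fun x => - (expR (- x) * (conjA q).[x]).
Proof.
apply/funext => x; rewrite /opA.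
have -> : (fun y => y * derive1 (fun y => expR (- y) * q.[y]) y) =
    fun y => expR (- y) * ('X * (q^`() - q)).[y].
  by apply/funext => y; rewrite derive1_expRNM hornerM hornerX mulrCA.
rewrite derive1_expRNM /conjA mulrBr !derivB !derivM derivX !mul1r.
by rewrite !hornerE /=; ring.
Qed.

Lemma pfun_horner n x : pfun n x = (iter n conjA 1).[x].
Proof.
have iterA : iter n (@opA R) (fun y => expR (- y)) =
    fun y => (-1) ^+ n * (expR (- y) * (iter n conjA 1).[y]).
  elim: n => [|n IH].
    by apply/funext => y; rewrite /= hornerC mulr1 mul1r.
  rewrite iterS IH.
  have -> : (fun y => (-1) ^+ n * (expR (- y) * (iter n conjA 1).[y])) =
      (fun y => expR (- y) * ((-1) ^+ n *: iter n conjA 1).[y]).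
    by apply/funext => y; rewrite hornerZ mulrCA.
  rewrite opA_expRNM; apply/funext => y; rewrite iterS exprS.
  have -> a q : conjA (a *: q) = a *: conjA q.
    rewrite /conjA !derivZ -!scalerAr !derivZ -!scalerAr !scalerBr !scalerA.
    by rewrite [2 * a]mulrC.
  by rewrite hornerZ; ring.
rewrite /pfun iterA mulrACA -exprMn mulrNN mulr1 expr1n mul1r mulrA -expRD.
by rewrite subrr expR0 mul1r.
Qed.

Lemma coef_conjA q k :
  (conjA q)`_k = (k ^ 2)%:R * q`_k -
    (if k is j.+1 then (2 * j).+1%:R * q`_j else 0).
Proof.
have theta p j : ('X * p^`())`_j = j%:R * p`_j.
  by rewrite coefXM mulr_natl; case: j => [|j] //=; rewrite coef_deriv.
rewrite /conjA !coefB coefZ !theta !coefXM natrX expr2.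
by case: k => [|k] /=; rewrite -?coefXM ?theta; ring.
Qed.

(** The coefficients multiplied by k! satisfy the recurrence of the central
    moments, with the same initial values. *)
Lemma coef_iter_conjA n k :
  (iter n conjA 1)`_k = (k`!%:R)^-1 * central_moment R k n.
Proof.
elim: n k => [|n IH] [|k].
- by rewrite /= coef1 /central_moment /= hornerC invr1 mulr1.
- by rewrite /= coef1 central_momentS0 mulr0.
- by rewrite iterS coef_conjA central_moment0S mulr0 mul0r subr0.
rewrite iterS coef_conjA !IH central_momentSS factS.
have fk : k`!%:R != 0 :> R by rewrite pnatr_eq0 -lt0n fact_gt0.
have k1 : k.+1%:R != 0 :> R by rewrite pnatr_eq0.
rewrite !natrM; field.
by rewrite fk nat1r k1.
Qed.

Lemma pfun_central_moment n x :
  pfun n x = \sum_(0 <= k < n.+1) (k`!%:R)^-1 * central_moment R k n * x ^+ k.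
Proof.
rewrite pfun_horner (@horner_coef_wide _ n.+1) ?big_mkord.
  by apply: eq_bigr => k _; rewrite coef_iter_conjA.
apply/leq_sizeP => k lt_nk.
by rewrite coef_iter_conjA central_moment_small ?mulr0.
Qed.

End ConjugatedOperator.

(** * Gamma at positive integers *)

Section GammaFactorial.
Context {R : realType}.

Lemma exprM_expRN_cvg0 k : (x : R) ^+ k * expR (- x) @[x --> +oo] --> (0 : R).
Proof.
apply/cvgrPdist_lt => e e0; near=> x.
have x0 : 0 < x by near: x; exact: nbhs_pinfty_gt.
rewrite sub0r normrN ger0_norm ?mulr_ge0 ?exprn_ge0 ?expR_ge0 ?ltW //.
rewrite expRN ltr_pdivrMr ?expR_gt0 //.
have le_exp : x ^+ k.+1 / k.+1`!%:R <= expR x.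
  by apply: le_trans (expR_ge1Dxn k (ltW x0)); rewrite lerDr.
apply: lt_le_trans (ler_wpM2l (ltW e0) le_exp).
rewrite mulrA ltr_pdivlMr ?ltr0n ?fact_gt0 // exprSr.
rewrite mulrCA ltr_pM2l ?exprn_gt0 //.
have : k.+1`!%:R / e < x by near: x; apply: nbhs_pinfty_gt; exact: num_real.
by rewrite ltr_pdivrMr // mulrC.
Unshelve. all: by end_near. Qed.

Lemma horner_expRN_cvg0 (p : {poly R}) :
  expR (- x) * p.[x] @[x --> +oo] --> (0 : R).
Proof.
suff H j : expR (- x) * p.[x] * x ^+ j @[x --> +oo] --> (0 : R).
  by have := H 0; under eq_fun do rewrite expr0 mulr1.
elim/poly_ind: p j => [|p c IH] j.
  by under eq_fun do rewrite horner0 mulr0 mul0r; exact: cvg_cst.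
have -> : (fun x => expR (- x) * (p * 'X + c%:P).[x] * x ^+ j) =
    (fun x => expR (- x) * p.[x] * x ^+ j.+1 + c * (x ^+ j * expR (- x))).
  by apply/funext => x; rewrite hornerMXaddC exprS; ring.
rewrite -[X in _ --> X]addr0 -[X in _ --> _ + X](mulr0 c).
exact: cvgD (IH j.+1) (cvgM (cvg_cst c) (exprM_expRN_cvg0 j)).
Qed.

Lemma continuous_expRNM (p : {poly R}) :
  continuous (fun x => expR (- x) * p.[x]).
Proof.
move=> x; apply/differentiable_continuous/derivable1_diffP.
by have [] := is_derive_expRNM p x.
Qed.

(** If q - q' = X^n then - e^(-t) q(t) is an antiderivative of t^n e^(-t) which
    tends to 0 at infinity, so the integral is q(0). *)
Lemma Gamma_nat n : Gamma (n.+1%:R : R) = n`!%:R.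
Proof.
have [q [q0 dq]] : exists q : {poly R}, q.[0] = n`!%:R /\ q - q^`() = 'X^n.
  elim: n => [|n [q [q0 dq]]]; first by exists 1; rewrite hornerC derivC subr0.
  exists ('X^(n.+1) + q *+ n.+1); split.
    by rewrite hornerD hornerXn hornerMn q0 expr0n add0r factS natrM mulr_natl.
  by rewrite derivD derivXn derivMn opprD addrACA -mulrnBl dq /= addrNK.
have -> : Gamma n.+1%:R =
    \int[lebesgue_measure]_(t in `[0, +oo[)
      (expR (- t) * ('X^n : {poly R}).[t]).
  transitivity
    (\int[lebesgue_measure]_(t in `]0, +oo[)
       (expR (- t) * ('X^n : {poly R}).[t])).
    rewrite /Gamma -[in n.+1%:R]natr1 addrK.
    apply: eq_Rintegral => t; rewrite inE /= in_itv /= andbT => /ltW t0.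
    by rewrite powR_mulrn // mulrC hornerXn.
  rewrite /Rintegral integral_itv_obnd_cbnd //.
  apply/measurable_EFinP; apply: measurable_funTS.
  exact: measurable_realfun.continuous_measurable_fun (@continuous_expRNM 'X^n).
rewrite (@Rintegral_ge0_continuous_FTC2y _ _
  (fun y => expR (- y) * (- q).[y]) 0 0).
- by rewrite oppr0 expR0 mul1r hornerN opprK add0r q0.
- by move=> x x0; rewrite mulr_ge0 ?expR_ge0 ?hornerXn ?exprn_ge0.
- exact/continuous_subspaceT/continuous_expRNM.
- exact: horner_expRN_cvg0.
- by move=> x _; have [] := is_derive_expRNM (- q) x.
- exact/cvg_at_right_filter/continuous_expRNM.
- move=> x _; rewrite derive1E; have [_ ->] := is_derive_expRNM (- q) x.
  by rewrite derivN opprK addrC dq.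
Qed.

End GammaFactorial.

(** * Regrouping a double series by diagonals *)

Section Series.
Context {R : realType}.

Lemma cvg_series_sum (f : nat -> nat -> R) (l : nat -> R) M :
  (forall m, series (f m) @ \oo --> l m) ->
  series (fun N => \sum_(0 <= m < M) f m N) @ \oo --> \sum_(0 <= m < M) l m.
Proof.
move=> fl; elim: M => [|M IH].
  rewrite big_nil (_ : series _ = fun=> 0); first exact: cvg_cst.
  by apply/funext => N; rewrite seriesEnat /= big1 // => k _; rewrite big_nil.
rewrite big_nat_recr //=.
rewrite (_ : series _ =
  series (fun N => \sum_(0 <= m < M) f m N) + series (f M)).
  exact: cvgD.
by rewrite -seriesD; congr series; apply/funext => N; rewrite big_nat_recr.
Qed.

(** A double series regrouped by the total degree N becomes a triangular array
    [s m N], zero for N < m.  A summable bound [G] of the absolute sums over the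
    finite columns replaces Fubini's theorem. *)
Section Triangular.
Context {s : nat -> nat -> R} {G : nat -> R}.
Context (s_tri : forall m N, (N < m)%N -> s m N = 0).
Context (s_le : forall N, \sum_(0 <= m < N.+1) `|s m N| <= G N).
Context (cvg_G : cvgn (series G)).

Let G_ge0 N : 0 <= G N.
Proof. by apply: le_trans (s_le N); apply: sumr_ge0. Qed.

Let sum_tri (f : nat -> nat -> R) M N :
  (forall m, (N < m)%N -> f m N = 0) ->
  \sum_(0 <= m < M) f m N = \sum_(0 <= m < N.+1 | (m < M)%N) f m N.
Proof.
move=> f0.
transitivity (\sum_(0 <= m < maxn M N.+1 | (m < M)%N) f m N).
  rewrite [RHS](big_cat_nat (n := M)) ?leq_maxl //= [X in _ + X]big1_seq ?addr0.
    by rewrite !big_mkord; apply: eq_bigl => m; rewrite ltn_ord.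
  by move=> m /andP[mM]; rewrite mem_index_iota leqNgt mM.
rewrite (big_cat_nat (n := N.+1)) ?leq_maxr //= [X in _ + X]big1_seq ?addr0 //.
by move=> m /andP[mM]; rewrite mem_index_iota => /andP[Nm _]; exact: f0.
Qed.

Let sum_norm_le M N : \sum_(0 <= m < M) `|s m N| <= G N.
Proof.
rewrite (sum_tri (fun m N => `|s m N|)); last first.
  by move=> m /s_tri ->; rewrite normr0.
apply: le_trans (s_le N); rewrite big_mkcond; apply: ler_sum => m _.
by case: ifP.
Qed.

Let norm_le m N : `|s m N| <= G N.
Proof.
apply: le_trans (sum_norm_le m.+1 N); rewrite big_nat_recr //= lerDr.
exact: sumr_ge0.
Qed.

Let cvg_norm_s m : cvgn [normed series (s m)].
Proof. exact: (series_le_cvg _ G_ge0 (norm_le m) cvg_G). Qed.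

Lemma cvg_triangular_row m : cvgn (series (s m)).
Proof. exact: normed_cvg. Qed.

Lemma cvg_triangular_abs : cvgn (series (fun m => `|limn (series (s m))|)).
Proof.
apply: nondecreasing_is_cvgn; first exact: nondecreasing_series.
exists (limn (series G)) => _ [M _ <-].
apply: (@le_trans _ _ (\sum_(0 <= m < M) limn [normed series (s m)])).
  by apply: ler_sum => m _; exact: lim_series_norm.
have H := cvg_series_sum (fun m N => `|s m N|) _ M cvg_norm_s.
rewrite -(cvg_lim _ H) //; apply: lim_series_le => //; first exact: cvgP H.
Qed.

(** Removing the first M rows from the columns leaves nothing in the columns
    N < M, and at most [G N] in the others; hence the error made by stopping at
    the row M is bounded by the tail of the series of [G]. *)
Lemma cvg_triangular_sum :
  series (fun m => limn (series (s m))) @ \oo -->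
  limn (series (fun N => \sum_(0 <= m < N.+1) s m N)).
Proof.
pose T N := \sum_(0 <= m < N.+1) s m N; pose L m := limn (series (s m)).
change (series L @ \oo --> limn (series T)).
have cvg_T : cvgn (series T).
  apply: normed_cvg; apply: (series_le_cvg _ G_ge0 _ cvg_G) => N /=.
    exact: normr_ge0.
  by apply: le_trans (s_le N); exact: ler_norm_sum.
have bound M : `|limn (series T) - series L M| <= limn (series G) - series G M.
  (* What remains of the column N after removing the first M rows. *)
  pose e N := T N - \sum_(0 <= m < M) s m N.
  have e0 N : (N < M)%N -> e N = 0.
    move=> NM; rewrite /e /T (sum_tri s M) //; last by move=> m /s_tri.
    rewrite !big_mkord [X in _ - X](eq_bigl xpredT) ?subrr // => m.
    by rewrite (leq_trans (ltn_ord m)).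
  have e_le N : `|e N| <= G N.
    rewrite /e /T (sum_tri s M) //; last by move=> m /s_tri.
    rewrite [X in X - _](bigID (fun m => (m < M)%N)) /= addrAC subrr add0r.
    apply: le_trans (ler_norm_sum _ _ _) _; apply: le_trans (s_le N).
    by rewrite big_mkcond; apply: ler_sum => m _; case: ifP.
  have cvg_e : series e @ \oo --> limn (series T) - series L M.
    rewrite (_ : series e =
      series T - series (fun N => \sum_(0 <= m < M) s m N)).
      by apply: cvgB => //; apply: cvg_series_sum; exact: cvg_triangular_row.
    by rewrite -seriesN -seriesD.
  rewrite -(cvg_lim _ cvg_e) // -lim_norm; last exact: cvgP cvg_e.
  apply: limr_le; first exact: is_cvg_norm (cvgP _ cvg_e).
  near=> n; have le_Mn : (M <= n)%N by near: n; exact: nbhs_infty_ge.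
  apply: (@le_trans _ _ (series G n - series G M)); last first.
    rewrite lerB // nondecreasing_cvgn_le //; exact: nondecreasing_series.
  rewrite !seriesEnat /= (big_cat_nat (n := M)) //= big1_seq ?add0r; last first.
    by move=> N /andP[_]; rewrite mem_index_iota => /andP[_ /e0].
  rewrite [X in X - _](big_cat_nat (n := M)) //= addrAC subrr add0r.
  apply: le_trans (ler_norm_sum _ _ _) _.
  by apply: ler_sum => N _; exact: e_le.
apply/cvgrPdist_le => eps eps0; near=> M; apply: le_trans (bound M) _.
apply: le_trans (ler_norm _) _.
by near: M; move/cvgrPdist_le : cvg_G; apply.
Unshelve. all: by end_near. Qed.

End Triangular.
End Series.

(** * The Bessel series *)

Section BesselSeries.
Context {R : realType}.

Definition binom_moment N n : R :=
  \sum_(0 <= k < N.+1) 'C(N, k)%:R * (N%:R - 2 * k%:R) ^+ (2 * n).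

(** As 'C(N, k)/N! = 1/(k! (N - k)!), this is the exponential series shifted by
    k places. *)
Lemma cvg_exp_coeff_bin (z : R) k :
  series (fun N => z ^+ N / N`!%:R * 'C(N, k)%:R) @ \oo -->
  z ^+ k / k`!%:R * expR z.
Proof.
rewrite -(cvg_shiftn k).
rewrite (_ : (fun N => _) = (z ^+ k / k`!%:R) *: series (exp_coeff z)).
  by apply: cvgZr; exact: is_cvg_series_exp_coeff.
apply/funext => N; rewrite seriesEnat /= (big_cat_nat (n := k)) ?leq_addl //=.
rewrite big_nat big1 ?add0r; last first.
  by move=> i /andP[_ ik]; rewrite bin_small ?mulr0.
rewrite -[k in LHS]add0n big_addn addnK.
transitivity (z ^+ k / k`!%:R * \sum_(0 <= i < N) exp_coeff z i); last by [].
rewrite mulr_sumr; apply: eq_bigr => i _; rewrite /exp_coeff /=.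
have := bin_fact (leq_addl i k); rewrite addnK => /(congr1 (fun j => j%:R : R)).
rewrite !natrM => <-; rewrite exprD.
have b0 : 'C(i + k, k)%:R != 0 :> R by rewrite pnatr_eq0 -lt0n bin_gt0 leq_addl.
have k0 : k`!%:R != 0 :> R by rewrite pnatr_eq0 -lt0n fact_gt0.
have i0 : i`!%:R != 0 :> R by rewrite pnatr_eq0 -lt0n fact_gt0.
by field; rewrite b0 k0 i0.
Qed.

(** The moment of order N is a combination of the n + 1 binomials 'C(N, k), and
    each of them sums to a multiple of z^k e^z; the coefficients are those of
    p_n, up to the sign (-1)^k. *)
Lemma cvg_binom_moment (z : R) n :
  series (fun N => z ^+ N / N`!%:R * ((2 ^+ N)^-1 * binom_moment N n)) @ \oo -->
  expR z * pfun n (- z).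
Proof.
rewrite pfun_central_moment mulr_sumr.
pose f k N : R := (-1) ^+ k * central_moment R k n *
  (z ^+ N / N`!%:R * 'C(N, k)%:R).
have -> : (fun N => z ^+ N / N`!%:R * ((2 ^+ N)^-1 * binom_moment N n)) =
    fun N => \sum_(0 <= k < n.+1) f k N.
  apply/funext => N; rewrite /binom_moment sum_binom_central_moment mulr_sumr.
  by apply: eq_bigr => k _; rewrite /f; ring.
apply: cvg_series_sum => k.
rewrite (_ : expR z * _ =
  (-1) ^+ k * central_moment R k n * (z ^+ k / k`!%:R * expR z)); last first.
  by rewrite [(- z) ^+ k]exprNn; ring.
rewrite (_ : series (f k) = ((-1) ^+ k * central_moment R k n) *:
   series (fun N => z ^+ N / N`!%:R * 'C(N, k)%:R)).
  by apply: cvgZr; exact: cvg_exp_coeff_bin.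
by rewrite -seriesZ.
Qed.

(** The reflection k |-> N - k exchanges the indices below N/2 with those above,
    and a middle index contributes 0, so it may be counted twice. *)
Lemma sum_half (f : nat -> R) N :
  (forall k, (k <= N)%N -> f (N - k)%N = f k) ->
  (forall k, (2 * k)%N = N -> f k = 0) ->
  \sum_(k < N.+1) f k = 2 * \sum_(k < N.+1 | (2 * k <= N)%N) f k.
Proof.
move=> f_sym f_mid; rewrite (bigID (fun k : 'I_N.+1 => (2 * k <= N)%N)) /=.
rewrite mulr_natl mulr2n; congr (_ + _).
rewrite (reindex_inj rev_ord_inj) /=.
rewrite [RHS]big_mkcond [LHS]big_mkcond; apply: eq_bigr => k _ /=.
have le_kN : (k <= N)%N by rewrite -ltnS.
rewrite subSS f_sym // -ltnNge.
have [kN|kN|kN] := ltngtP (2 * k)%N N.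
- by case: ifP => //; lia.
- by case: ifP => //; lia.
- by rewrite f_mid // if_same.
Qed.

Section Terms.
Context {n : nat} {x : R} (n_gt0 : (0 < n)%N) (x_gt0 : 0 < x).

(* The term of degree 2k + m in the expansion of the m-th summand, and the
   contribution of degree N to that summand. *)
Let t m k : R := (-1) ^+ m * m%:R ^+ (2 * n) *
  ((x / 2) ^+ (2 * k + m) / (k`!%:R * (k + m)`!%:R)).

Let s m N : R := \sum_(k < N.+1 | (2 * k + m == N)%N) t m k.

Let termE m k N : (2 * k + m = N)%N ->
  t m k = (-1) ^+ N * ((x / 2) ^+ N / N`!%:R) *
    ('C(N, k)%:R * (N%:R - 2 * k%:R) ^+ (2 * n)).
Proof.
move=> eN; have le_kN : (k <= N)%N by lia.
have eNk : (N - k = k + m)%N by lia.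
have := bin_fact le_kN; rewrite eNk => /(congr1 (fun i => i%:R : R)).
rewrite !natrM => <-.
have -> : (-1) ^+ N = (-1) ^+ m :> R.
  by rewrite -eN exprD exprM sqrrN !expr1n mul1r.
have -> : N%:R - 2 * k%:R = m%:R :> R by rewrite -eN natrD natrM; ring.
have b0 : 'C(N, k)%:R != 0 :> R by rewrite pnatr_eq0 -lt0n bin_gt0.
have k0 : k`!%:R != 0 :> R by rewrite pnatr_eq0 -lt0n fact_gt0.
have m0 : (k + m)`!%:R != 0 :> R by rewrite pnatr_eq0 -lt0n fact_gt0.
rewrite /t -eN; field.
by rewrite k0 m0 eN b0.
Qed.

(* On the diagonal of degree N each k with 2k <= N occurs once, with
   m = N - 2k. *)
Let sum_rows (g : nat -> R) N :
  \sum_(0 <= m < N.+1) \sum_(k < N.+1 | (2 * k + m == N)%N) g k =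
  \sum_(k < N.+1 | (2 * k <= N)%N) g k.
Proof.
rewrite big_mkord (exchange_big_dep (fun k : 'I_N.+1 => (2 * k <= N)%N)) /=.
  apply: eq_bigr => k le_kN.
  have lt_m : (N - 2 * k < N.+1)%N by lia.
  rewrite (big_pred1 (Ordinal lt_m)) // => m /=.
  by rewrite -val_eqE /=; apply/eqP/eqP; lia.
by move=> m k _ /eqP; lia.
Qed.

Let half_moment N :
  \sum_(k < N.+1 | (2 * k <= N)%N) 'C(N, k)%:R * (N%:R - 2 * k%:R) ^+ (2 * n)
  = 2^-1 * binom_moment N n.
Proof.
pose f k : R := 'C(N, k)%:R * (N%:R - 2 * k%:R) ^+ (2 * n).
rewrite /binom_moment big_mkord (sum_half f) ?mulKf ?pnatr_eq0 // /f.
  move=> k le_kN; rewrite bin_sub // natrB // !exprM.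
  by congr (_ * _ ^+ _); ring.
move=> k <-; rewrite natrM subrr expr0n.
by rewrite muln_eq0 /= -[n == 0%N]negbK -lt0n n_gt0 mulr0.
Qed.

Let s_tri m N : (N < m)%N -> s m N = 0.
Proof. by move=> Nm; rewrite /s big_pred0 // => k; apply/eqP; lia. Qed.

(* The sum of |s m N| over m, written so that the series of [G] is half of the
   series of binomial moments at x. *)
Let G N : R := 2^-1 * (x ^+ N / N`!%:R * ((2 ^+ N)^-1 * binom_moment N n)).

Let s_le N : \sum_(0 <= m < N.+1) `|s m N| <= G N.
Proof.
pose g k : R := (x / 2) ^+ N / N`!%:R *
  ('C(N, k)%:R * (N%:R - 2 * k%:R) ^+ (2 * n)).
have -> : G N = \sum_(k < N.+1 | (2 * k <= N)%N) g k.
  by rewrite /g -mulr_sumr half_moment /G exprMn exprVn; ring.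
rewrite -sum_rows; apply: ler_sum => m _.
apply: le_trans (ler_norm_sum _ _ _) _; apply: ler_sum => k /eqP /termE ->.
rewrite -mulrA normrM normrX normrN1 expr1n mul1r ger0_norm //.
apply: mulr_ge0; first by rewrite divr_ge0 ?exprn_ge0 ?divr_ge0 ?ltW.
by rewrite mulr_ge0 // exprM exprn_ge0 // sqr_ge0.
Qed.

Let diagE N : \sum_(0 <= m < N.+1) s m N =
  2^-1 * ((- x) ^+ N / N`!%:R * ((2 ^+ N)^-1 * binom_moment N n)).
Proof.
pose g k : R := (-1) ^+ N * ((x / 2) ^+ N / N`!%:R) *
  ('C(N, k)%:R * (N%:R - 2 * k%:R) ^+ (2 * n)).
transitivity (\sum_(k < N.+1 | (2 * k <= N)%N) g k).
  rewrite -sum_rows; apply: eq_bigr => m _.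
  by apply: eq_bigr => k /eqP /termE.
by rewrite /g -mulr_sumr half_moment exprMn exprVn [(- x) ^+ N]exprNn; ring.
Qed.

Let cvg_G : cvgn (series G).
Proof.
exact: @is_cvg_seriesZ _ _ 2^-1 (cvgP _ (cvg_binom_moment x n)).
Qed.

(* In row m only the degrees of the parity of m contribute, so the partial sums
   of the power series of I_m form a subsequence of those of the row. *)
Let sub_series m K : series (s m) (2 * K + m)%N = \sum_(0 <= k < K) t m k.
Proof.
rewrite seriesEnat /=.
elim: K => [|K IH].
  by rewrite [RHS]big_geq // big_nat big1 // => N /andP[_ Nm]; exact: s_tri.
have -> : (2 * K.+1 + m = (2 * K + m).+2)%N by lia.
rewrite !big_nat_recr //= IH -addrA; congr (_ + _).
rewrite [X in _ + X]big_pred0 ?addr0; last by move=> k; apply/eqP; lia.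
have lt_K : (K < (2 * K + m).+1)%N by lia.
rewrite /s (big_pred1 (Ordinal lt_K)) // => k /=.
by rewrite -val_eqE /=; apply/eqP/eqP; lia.
Qed.

Let row_lim m : (0 < m)%N ->
  limn (series (s m)) = (-1) ^+ m * m%:R ^+ (2 * n) * besselI m%:R x.
Proof.
move=> m_gt0; pose c : R := (-1) ^+ m * m%:R ^+ (2 * n); rewrite -/c.
have c0 : c != 0.
  by rewrite /c mulf_eq0 signr_eq0 expf_eq0 pnatr_eq0 (gtn_eqF m_gt0) andbF.
have cs := cvg_triangular_row s_tri s_le cvg_G m.
have sub : (fun K => \sum_(0 <= k < K) t m k) @ \oo --> limn (series (s m)).
  rewrite (_ : (fun K => _) = series (s m) \o (addn^~ m \o muln 2)).
    apply: cvg_comp cs; apply: (cvg_comp _ (addn^~ m)); first exact: cvg_mulnl.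
    exact: cvg_addnr.
  by apply/funext => K /=; rewrite sub_series.
rewrite /besselI.
rewrite (_ : (fun K => _) = c^-1 *: (fun K => \sum_(0 <= k < K) t m k)).
  have sub_c : c^-1 *: (fun K => \sum_(0 <= k < K) t m k) @ \oo -->
      c^-1 *: limn (series (s m)) by exact: cvgZr.
  by rewrite (cvg_lim _ sub_c) // mulVKf.
apply/funext => K; transitivity (c^-1 * \sum_(0 <= k < K) t m k); last by [].
rewrite mulr_sumr; apply: eq_bigr => k _.
rewrite /t -/c -natrD powR_mulrn ?divr_ge0 ?(ltW x_gt0) //.
by rewrite natr1 -natrD addSn Gamma_nat mulKf.
Qed.

(* The row m = 0, absent from the theorem, vanishes because m^(2n) does. *)
Let row0 : limn (series (s 0)) = 0.
Proof.
rewrite (_ : series _ = fun=> 0); first exact: lim_cst.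
apply/funext => N; rewrite seriesEnat /= big1 // => i _.
rewrite /s big1 // => k _; rewrite /t expr0n muln_eq0 /=.
by rewrite -[n == 0%N]negbK -lt0n n_gt0 mulr0 mul0r.
Qed.

Lemma bessel_expansion :
  let u := fun m : nat => (-1) ^+ m * m%:R ^+ (2 * n) * besselI m%:R x in
  cvgn (fun N : nat => \sum_(1 <= m < N) `|u m|) /\
  pfun n x = 2 * expR x * \big[+%R/0]_(1 <= m <oo) u m.
Proof.
move=> u.
have from1 (h : R -> R) : h 0 = 0 ->
    (fun N : nat => \sum_(1 <= m < N) h (u m)) =
    series (fun m => h (limn (series (s m)))).
  move=> h0; apply/funext => -[|N]; first by rewrite seriesEnat /= !big_geq.
  rewrite seriesEnat /= [RHS]big_ltn // row0 h0 add0r big_nat [RHS]big_nat.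
  by apply: eq_bigr => m /andP[m_gt0 _]; rewrite row_lim.
split.
  rewrite (from1 Num.norm (normr0 _)).
  exact: cvg_triangular_abs s_tri s_le cvg_G.
have -> : \big[+%R/0]_(1 <= m <oo) u m = 2^-1 * (expR (- x) * pfun n x).
  rewrite (from1 id) //.
  rewrite (cvg_lim _ (cvg_triangular_sum s_tri s_le cvg_G)) //.
  under eq_fun do rewrite diagE.
  apply: cvg_lim => //.
  have := cvg_binom_moment (- x) n; rewrite opprK => cvg_x.
  rewrite (_ : series _ = 2^-1 *: series (fun N =>
    (- x) ^+ N / N`!%:R * ((2 ^+ N)^-1 * binom_moment N n))); last first.
    by rewrite -seriesZ.
  exact: cvgZr.
have expx0 : expR x != 0 by rewrite gt_eqF ?expR_gt0.
by rewrite expRN; field.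
Qed.

End Terms.
End BesselSeries.

Theorem theorem1 (R : realType) (n : nat) (n_gt0 : (0 < n)%N) :
  [/\ forall x : R, 0 < x ->
        let u := fun m : nat =>
          (-1) ^+ m * m%:R ^+ (2 * n) * besselI m%:R x in
        cvgn (fun N : nat => \sum_(1 <= m < N) `|u m|) /\
        pfun n x = 2 * expR x * \big[+%R/0]_(1 <= m <oo) u m,
      forall x : R, pfun n x = \sum_(1 <= k < n.+1) acoef R k n * x ^+ k,
      forall k : nat, (n.+1 <= k <= 2 * n)%N -> binom_dsum R k n = 0
    & binom_dsum R n n = (-1) ^+ n * n`!%:R * (odd_dfact n)%:R].
Proof.
split.
- by move=> x x_gt0; exact: bessel_expansion.
- move=> x; rewrite pfun_central_moment big_ltn //.
  have -> : central_moment R 0 n = 0.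
    by rewrite -(prednK n_gt0) central_moment0S.
  rewrite mulr0 mul0r add0r; apply: eq_bigr => k _.
  by rewrite /acoef binom_dsumE.
- by move=> k /andP[lt_nk _]; rewrite binom_dsumE central_moment_small.
- by rewrite binom_dsumE central_moment_diag.
Qed.
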